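(* Let $\mathscr{H}(K)$ be a reproducing kernel Hilbert space on $X$ with feature map $\phi(x)=k_x$, let $\mu$ be a probability measure on $X$, let $M>0$ and $p>1$, and let $g:X\to\mathbb{F}$ satisfy $|g|^p\in L^1(X,\mu)$. Let $\hat f\in\mathscr{H}(K)$ be the unique optimizer (under these hypotheses an optimizer exists and is unique) of the problem $$\inf_{f\in\mathscr{H}(K)} \int_X |f(x)-g(x)|^p\,d\mu(x)\quad\text{such that}\quad\|f\|_{\mathscr{H}(K)}\le M.$$ Assume the probability measure $\mu$ satisfies that for any $\mathbb{F}$-measure $\xi$ on $X$ with $\operatorname{supp}(\xi)\subset\operatorname{supp}(\mu)$, $$\int_X\|\phi(x)\|_{\mathscr{H}(K)}\,d|\xi|(x)<+\infty .$$ Then there exists a sequence of $\mathbb{F}$-measures $\{\nu_n\}_{n=1}^\infty$ on $X$ with $\operatorname{supp}(\nu_n)\subset\operatorname{supp}(\mu)$ such that $$\hat f=\lim_{n\to\infty}\int_X\phi(x)\,d\nu_n(x).$$ Furthermore, if $\mu$ is finitely supported, or $\mathscr{H}(K)$ is finite-dimensional, then there exists an $\mathbb{F}$-measure $\nu$ on $X$ with $\operatorname{supp}(\nu)\subset\operatorname{supp}(\mu)$ such that $$\hat f=\int_X\phi(x)\,d\nu(x).$$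
   Context: $\mathbb{F}=\mathbb{R}$ or $\mathbb{C}$. A reproducing kernel Hilbert space (RKHS) on $X$ is a vector subspace $\mathscr{H}$ of the space of all functions $X\to\mathbb{F}$ equipped with a Hilbert space inner product $\langle\cdot,\cdot\rangle$ ($\mathbb{F}$-linear in the first argument) such that each evaluation functional $f\mapsto f(x)$, $x\in X$, is bounded. For $x\in X$, $k_x\in\mathscr{H}$ is the unique vector with $f(x)=\langle f,k_x\rangle$ for all $f\in\mathscr{H}$; the reproducing kernel is $K(y,x)=k_x(y)$, and $\mathscr{H}(K)$ denotes the RKHS with reproducing kernel $K$. Standing assumptions: $X$ is a Polish space, and all functions and measures are Borel measurable. An optimizer is an element of $\mathscr{H}(K)$ of norm at most $M$ attaining the infimum. An $\mathbb{F}$-measure on $X$ is a complex measure on $X$ if $\mathbb{F}=\mathbb{C}$ and a signed measure on $X$ if $\mathbb{F}=\mathbb{R}$; $|\xi|$ is the variation measure of $\xi$, and $\operatorname{supp}$ denotes the support. The integral $\int_X\phi\,d\xi\in\mathscr{H}(K)$ is the Pettis integral, i.e. the element determined by $\langle\int_X\phi(x)\,d\xi(x),f\rangle_{\mathscr{H}(K)}=\int_X\langle\phi(x),f\rangle_{\mathscr{H}(K)}\,d\xi(x)$ for all $f\in\mathscr{H}(K)$; the limit is taken in $\mathscr{H}(K)$.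
   Formalization: The parenthetical claim that an optimizer exists and is unique is not proved; uniqueness can fail (μ a point mass at x, H two-dimensional on {x,y}, g=0). That the given optimizer exists and is the only one is a hypothesis instead. *)

(* Defs.v *)
From HB Require Import structures.
From mathcomp Require Import all_boot all_order all_algebra.
From mathcomp Require Import all_classical all_reals all_analysis.
From mathcomp Require Import complex.
Set Implicit Arguments.
Unset Strict Implicit.
Unset Printing Implicit Defensive.
Import Order.TTheory GRing.Theory Num.Theory.
Import numFieldNormedType.Exports.
Local Open Scope classical_set_scope.
Local Open Scope ring_scope.

Variant scalar_kind := real_scalars | complex_scalars.

Definition scalar_field (R : realType) (k : scalar_kind) : numFieldType :=
  match k with
  | real_scalars => R : numFieldType
  | complex_scalars => R[i] : numFieldType
  end.

Section scalars.
Variable R : realType.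

Definition sre (k : scalar_kind) : scalar_field R k -> R :=
  match k with
  | real_scalars => fun x => x
  | complex_scalars => fun z => complex.Re z
  end.

Definition sim (k : scalar_kind) : scalar_field R k -> R :=
  match k with
  | real_scalars => fun=> 0
  | complex_scalars => fun z => complex.Im z
  end.

Definition sconj (k : scalar_kind) : scalar_field R k -> scalar_field R k :=
  match k with
  | real_scalars => fun x => x
  | complex_scalars => fun z => conjc z
  end.

(* a + i b; for real scalars only b = 0 makes sense and b is dropped *)
Definition smake (k : scalar_kind) : R -> R -> scalar_field R k :=
  match k with
  | real_scalars => fun a _ => a
  | complex_scalars => fun a b => Complex a b
  end.

(* The norm of a numFieldType takes its values in that field; this is the
   same norm as an element of R. *)
Definition sabs (k : scalar_kind) (z : scalar_field R k) : R := sre `|z|.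

End scalars.

Definition borel (T : ptopologicalType) := g_sigma_algebraType (@open T).

Definition borel_fun (S T : ptopologicalType) (f : S -> T) : Prop :=
  measurable_fun setT (f : borel S -> borel T).

Definition polish (R : realType) (X : ptopologicalType) : Prop :=
  (exists2 S : set X, countable S & dense S) /\
  exists d : X -> X -> R,
    [/\ forall x y, d x y = 0 <-> x = y,
        forall x y, d x y = d y x,
        forall x y z, d x z <= d x y + d y z,
        forall (x : X) (A : set X),
          nbhs x A <-> exists2 e : R, 0 < e & [set y | d x y < e] `<=` A &
        forall u : nat -> X,
          (forall e : R, 0 < e ->
             exists N, forall m n, (N <= m)%N -> (N <= n)%N -> d (u m) (u n) < e) ->
          exists l : X, u @ \oo --> l].

Section F_measures.
Variables (R : realType) (k : scalar_kind) (X : ptopologicalType).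
Local Notation F := (scalar_field R k).

(* Charges are finite on measurable sets and countably additive for the
   topology of F: signed measures if F = R, complex measures if F = R[i]. *)
Definition Fmeasure := {charge set (borel X) -> \bar F}.

Definition Fvariation (xi : set (borel X) -> \bar F) (A : set (borel X)) :
    \bar R :=
  ereal_sup [set s | exists E : nat -> set (borel X),
    [/\ forall i, measurable (E i), trivIset setT E, \bigcup_i E i = A &
        s = (\sum_(i <oo) (sabs (fine (xi (E i))))%:E)%E]].

Definition msupport (m : set (borel X) -> \bar R) : set X :=
  [set x | forall U : set X, open U -> U x -> (0 < m U)%E].

Definition Fsupport (xi : set (borel X) -> \bar F) : set X :=
  msupport (Fvariation xi).

(* Jordan decomposition of a finite signed measure: the positive variation is
   upper_variation s, the negative one upper_variation (- s). *)
Definition upper_variation (s : set (borel X) -> R) (A : set (borel X)) :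
    \bar R :=
  ereal_sup [set (s B)%:E | B in [set B | measurable B /\ B `<=` A]].

Definition signed_integral (s : set (borel X) -> R) (h : X -> R) : R :=
  fine (\int[upper_variation s]_(x in setT) (h x)%:E)%E -
  fine (\int[upper_variation (fun A => (- s A)%R)]_(x in setT) (h x)%:E)%E.

Definition Fintegrable (xi : set (borel X) -> \bar F) (h : X -> F) : Prop :=
  borel_fun h /\
  (\int[Fvariation xi]_(x in setT) (sabs (h x))%:E < +oo)%E.

Definition Fintegral (xi : set (borel X) -> \bar F) (h : X -> F) : F :=
  let xr A := sre (fine (xi A)) in
  let xj A := sim (fine (xi A)) in
  let hr x := sre (h x) in
  let hj x := sim (h x) in
  smake k (signed_integral xr hr - signed_integral xj hj)
          (signed_integral xr hj + signed_integral xj hr).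

End F_measures.

Section inner_product.
Variables (R : realType) (k : scalar_kind) (X : Type).
Local Notation F := (scalar_field R k).

Definition ip_norm (ip : (X -> F) -> (X -> F) -> F) (f : X -> F) : R :=
  Num.sqrt (sre (ip f f)).

(* rkhs_inner matters only on the carrier. *)
Record rkhs := Rkhs {
  rkhs_carrier :> (X -> F) -> Prop;
  rkhs_inner : (X -> F) -> (X -> F) -> F;
  rkhs0 : rkhs_carrier (fun=> 0);
  rkhs_lin : forall (a : F) (f g : X -> F),
    rkhs_carrier f -> rkhs_carrier g ->
    rkhs_carrier (fun x => a * f x + g x);
  rkhs_inner_lin : forall (a : F) (f g h : X -> F),
    rkhs_carrier f -> rkhs_carrier g -> rkhs_carrier h ->
    rkhs_inner (fun x => a * f x + g x) h =
      a * rkhs_inner f h + rkhs_inner g h;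
  rkhs_inner_conj : forall f g : X -> F,
    rkhs_carrier f -> rkhs_carrier g ->
    rkhs_inner g f = sconj (rkhs_inner f g);
  rkhs_inner_ge0 : forall f : X -> F,
    rkhs_carrier f -> 0 <= rkhs_inner f f;
  rkhs_inner_eq0 : forall f : X -> F,
    rkhs_carrier f -> rkhs_inner f f = 0 -> f = (fun=> 0);
  rkhs_complete : forall u : nat -> X -> F,
    (forall n, rkhs_carrier (u n)) ->
    (forall e : R, 0 < e ->
       exists N, forall m n, (N <= m)%N -> (N <= n)%N ->
         ip_norm rkhs_inner (fun x => u m x - u n x) < e) ->
    exists2 l : X -> F, rkhs_carrier l &
      ip_norm rkhs_inner (fun x => u n x - l x) @[n --> \oo] --> (0 : R);
  rkhs_eval_bounded : forall x : X, exists C : R,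
    forall f, rkhs_carrier f -> sabs (f x) <= C * ip_norm rkhs_inner f
}.

Definition rkhs_norm (H : rkhs) (f : X -> F) : R := ip_norm (rkhs_inner H) f.

Definition rkhs_cvg (H : rkhs) (u : nat -> X -> F) (l : X -> F) : Prop :=
  rkhs_norm H (fun x => u n x - l x) @[n --> \oo] --> (0 : R).

(* The feature map x |-> k_x of a kernel K, where K y x = k_x y. *)
Definition feature (K : X -> X -> F) (x : X) : X -> F := fun y => K y x.

Definition reproducing_kernel (H : rkhs) (K : X -> X -> F) : Prop :=
  forall x : X, H (feature K x) /\
    forall f : X -> F, H f -> f x = rkhs_inner H f (feature K x).

Definition finite_dimensional (H : rkhs) : Prop :=
  exists (n : nat) (b : 'I_n -> X -> F), (forall i, H (b i)) /\
    forall f, H f -> exists c : 'I_n -> F,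
      f = (fun x => \sum_(i < n) c i * b i x).

End inner_product.

Section problem.
Variables (R : realType) (k : scalar_kind) (X : ptopologicalType).
Local Notation F := (scalar_field R k).

Definition is_pettis_integral (H : rkhs R k X) (phi : X -> X -> F)
    (xi : Fmeasure R k X) (v : X -> F) : Prop :=
  H v /\ forall f, H f ->
    Fintegrable xi (fun x => rkhs_inner H (phi x) f) /\
    rkhs_inner H v f = Fintegral xi (fun x => rkhs_inner H (phi x) f).

Definition objective (mu : set (borel X) -> \bar R) (p : R) (g f : X -> F) :
    \bar R :=
  (\int[mu]_(x in setT) (sabs (f x - g x) `^ p)%:E)%E.

Definition optimizer (H : rkhs R k X) (mu : set (borel X) -> \bar R)
    (p M : R) (g f : X -> F) : Prop :=
  let feasible := [set h | H h /\ rkhs_norm H h <= M] in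
  feasible f /\
  objective mu p g f = ereal_inf [set objective mu p g h | h in feasible].

End problem.

(* Main.v *)
(** Let [S] be the support of [mu]; its complement is [mu]-null because [X] is
    second countable, so an element of the RKHS that agrees with the optimizer
    [fhat] on [S] and is not longer than [fhat] is again optimal, hence equals
    [fhat]. For a finite set [s] of points of [S], a combination of the kernel
    functions at the points of [s] that interpolates [fhat] on [s] is the
    orthogonal projection of [fhat] onto their span. Projections whose norms
    approach the supremum over all [s] form a Cauchy sequence, and the limit
    agrees with [fhat] on all of [S]. When [S] is finite or the RKHS is
    finite-dimensional, a single [s] already determines the values on [S].
    Finite combinations of kernel functions are Pettis integrals against
    finitely supported measures. *)

Require Import Defs.
From HB Require Import structures.
From mathcomp Require Import all_boot all_order all_algebra.
From mathcomp Require Import all_classical all_reals all_analysis.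
From mathcomp Require Import measurable_realfun complex ring lra.
Set Implicit Arguments.
Unset Strict Implicit.
Unset Printing Implicit Defensive.
Import Order.TTheory GRing.Theory Num.Theory.
Import numFieldNormedType.Exports.
Local Open Scope classical_set_scope.
Local Open Scope ring_scope.

(** * Real and imaginary parts, conjugation and modulus, uniformly in the scalar field *)

Section scalar_lemmas.
Variables (R : realType) (k : scalar_kind).
Local Notation F := (scalar_field R k).
Implicit Types a b z : F.

Lemma sreD a b : sre (a + b) = sre a + sre b.
Proof. by case: k a b => //= -[? ?] [? ?]. Qed.

Lemma simD a b : sim (a + b) = sim a + sim b.
Proof. by case: k a b => //= [_ _|[? ?] [? ?]//]; rewrite addr0. Qed.

Lemma sre0 : sre (0 : F) = 0.
Proof. by case: k. Qed.

Lemma sim0 : sim (0 : F) = 0.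
Proof. by case: k. Qed.

Lemma sreN a : sre (- a) = - sre a.
Proof. by case: k a => //= -[? ?]. Qed.

Lemma simN a : sim (- a) = - sim a.
Proof. by case: k a => [a|[? ?]] //=; rewrite oppr0. Qed.

Lemma sreB a b : sre (a - b) = sre a - sre b.
Proof. by rewrite sreD sreN. Qed.

Lemma simB a b : sim (a - b) = sim a - sim b.
Proof. by rewrite simD simN. Qed.

Lemma sreMn a n : sre (a *+ n) = sre a *+ n.
Proof. by elim: n => [|n IH]; rewrite ?sre0// !mulrS sreD IH. Qed.

Lemma sre_sum (I : Type) (r : seq I) (P : pred I) (f : I -> F) :
  sre (\sum_(i <- r | P i) f i) = \sum_(i <- r | P i) sre (f i).
Proof. exact: (big_morph _ sreD sre0). Qed.

Lemma sim_sum (I : Type) (r : seq I) (P : pred I) (f : I -> F) :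
  sim (\sum_(i <- r | P i) f i) = \sum_(i <- r | P i) sim (f i).
Proof. exact: (big_morph _ simD sim0). Qed.

Lemma sreM a b : sre (a * b) = sre a * sre b - sim a * sim b.
Proof. by case: k a b => [a b|[? ?] [? ?]]//=; rewrite mul0r subr0. Qed.

Lemma simM a b : sim (a * b) = sre a * sim b + sim a * sre b.
Proof. by case: k a b => [a b|[? ?] [? ?]]//=; rewrite mulr0 mul0r addr0. Qed.

Lemma smakeK a : smake k (sre a) (sim a) = a.
Proof. by case: k a => //= -[]. Qed.

Lemma sre_conj a : sre (sconj a) = sre a.
Proof. by case: k a => //= -[]. Qed.

Lemma sconjD a b : sconj (a + b) = sconj a + sconj b.
Proof. by case: k a b => //= a b; rewrite rmorphD. Qed.

Lemma sconjN a : sconj (- a) = - sconj a.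
Proof. by case: k a => //= a; rewrite rmorphN. Qed.

Lemma sconj0 : sconj (0 : F) = 0.
Proof. by case: k => //=; rewrite oppr0. Qed.

Lemma sre_ge0 z : 0 <= z -> 0 <= sre z.
Proof. by case: k z => //= -[a b]; rewrite lecE/= => /andP[]. Qed.

(** The order of [R[i]] only compares numbers with equal imaginary parts, so [0 <= z] makes [z]
    real. *)
Lemma ge0_sre_eq0 z : 0 <= z -> sre z = 0 -> z = 0.
Proof.
by case: k z => //= -[a b]; rewrite lecE/= => /andP[/eqP/= -> _] ->.
Qed.

Lemma sre_le z w : z <= w -> sre z <= sre w.
Proof. by rewrite -subr_ge0 => /sre_ge0; rewrite sreB subr_ge0. Qed.

Lemma sabs_ge0 z : 0 <= sabs z.
Proof. exact/sre_ge0/normr_ge0. Qed.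

Lemma sabs_eq0 z : sabs z = 0 -> z = 0.
Proof. by move=> /(ge0_sre_eq0 (normr_ge0 _))/normr0_eq0. Qed.

Lemma sabs0 : sabs (0 : F) = 0.
Proof. by rewrite /sabs normr0 sre0. Qed.

Lemma sabs1 : sabs (1 : F) = 1.
Proof. by rewrite /sabs normr1; case: k. Qed.

Lemma sabsN z : sabs (- z) = sabs z.
Proof. by rewrite /sabs normrN. Qed.

Lemma sabsD a b : sabs (a + b) <= sabs a + sabs b.
Proof. by rewrite /sabs -sreD; exact/sre_le/ler_normD. Qed.

Lemma sabs_sum (I : Type) (r : seq I) (P : pred I) (f : I -> F) :
  sabs (\sum_(i <- r | P i) f i) <= \sum_(i <- r | P i) sabs (f i).
Proof. by rewrite /sabs -sre_sum; exact/sre_le/ler_norm_sum. Qed.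

Lemma sabs_complex (z : scalar_field R complex_scalars) :
  sabs z = Num.sqrt (complex.Re z ^+ 2 + complex.Im z ^+ 2).
Proof. by have /= := congr1 (@complex.Re R) (normc_def (z : R[i])). Qed.

Lemma sim_norm z : sim `|z| = 0.
Proof. by case: k z. Qed.

Lemma sabsM a b : sabs (a * b) = sabs a * sabs b.
Proof.
by rewrite /sabs normrM sreM !sim_norm mul0r subr0.
Qed.

Lemma sabsE z : sabs z = Num.sqrt (sre z ^+ 2 + sim z ^+ 2).
Proof.
case: k z => [z|z]; last exact: sabs_complex.
by rewrite /= expr0n addr0 sqrtr_sqr.
Qed.

Lemma sabs_sre z : `|sre z| <= sabs z.
Proof.
by rewrite sabsE -[leLHS]sqrtr_sqr ler_sqrt ?addr_ge0 ?sqr_ge0// lerDl sqr_ge0.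
Qed.

Lemma sabs_sim z : `|sim z| <= sabs z.
Proof.
by rewrite sabsE -[leLHS]sqrtr_sqr ler_sqrt ?addr_ge0 ?sqr_ge0// lerDr sqr_ge0.
Qed.

Lemma sabs_dist a b : `|sabs a - sabs b| <= sabs (a - b).
Proof.
have := sabsD (a - b) b; rewrite subrK => h1.
have := sabsD (b - a) a; rewrite subrK -[b - a]opprB sabsN => h2.
by rewrite ler_norml; apply/andP; split; lra.
Qed.

Lemma norm_conj z : `|sconj z| = `|z|.
Proof. by case: k z => [z|[a b]]; rewrite // !normc_def/= sqrrN. Qed.

Lemma lipschitz_continuous (u : F -> R) :
  (forall a b, `|u a - u b| <= sabs (a - b)) -> continuous u.
Proof.
move=> hu z A /(nbhs_ballP (u z : R^o)) [e /= e0 eA].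
(* Balls of [F] have radii in [F], so the real bound [e] is turned into a positive scalar [d]; over
   [R[i]] a strict inequality gives one between real parts. *)
have [d d0 hd] : exists2 d : F, 0 < d & forall w : F, `|w| < d -> sabs w < e.
  rewrite /sabs; case: (k) => /=; first by exists e.
  exists e%:C%C; first by rewrite ltcR.
  by move=> w; rewrite ltcE => /andP[].
apply/(nbhs_ballP (z : F^o)); exists d => // y; rewrite -ball_normE /= => yd.
by apply: eA; rewrite -ball_normE; exact/(le_lt_trans (hu _ _))/hd.
Qed.

Lemma sconj_continuous : continuous (@sconj R k).
Proof.
move=> z A /(nbhs_ballP (sconj z : F^o)) [e /= e0 eA].
apply/(nbhs_ballP (z : F^o)); exists e => // y; rewrite -ball_normE /= => yd.
by apply: eA; rewrite -ball_normE /= -sconjN -sconjD norm_conj.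
Qed.

End scalar_lemmas.

(** * Borel measurability of scalar functions and of their real-valued parts *)

Section borel_functions.
Variables (R : realType) (k : scalar_kind) (X : ptopologicalType).
Local Notation F := (scalar_field R k).

Lemma open_measurable_borel (T : ptopologicalType) (U : set T) :
  open U -> measurable (U : set (borel T)).
Proof. exact: sub_sigma_algebra. Qed.

Lemma continuous_borel_fun (S T : ptopologicalType) (u : S -> T) :
  continuous u -> borel_fun u.
Proof.
move=> /continuousP cu.
apply: (@measurability _ _ (borel S) (borel T) _ _ open) => //.
move=> _ [V oV <-]; rewrite setTI; exact: open_measurable_borel (cu _ oV).
Qed.

Lemma borel_fun_comp (S T W : ptopologicalType) (u : T -> W) (h : S -> T) :
  borel_fun u -> borel_fun h -> borel_fun (u \o h).
Proof.
move=> mu mh; exact: (@measurableT_comp _ _ _ (borel S) (borel T) (borel W)).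
Qed.

(** Links two sigma-algebras on [R]: the one generated by all open sets and the standard one, which
    is generated by open intervals. *)
Lemma borel_fun_real (h : X -> R) :
  borel_fun h -> measurable_fun setT (h : borel X -> R).
Proof.
move=> mh; apply: (measurability _ (RGenOpens.measurableE R)).
move=> _ [_ [a [b ->] <-]].
apply: mh => //; apply: open_measurable_borel; exact: interval_open.
Qed.

Lemma borel_fun_lipschitz (u : F -> R) (h : X -> F) :
  (forall a b, `|u a - u b| <= sabs (a - b)) -> borel_fun h ->
  measurable_fun setT (fun x : borel X => u (h x)).
Proof.
move=> hu mh; apply: (@borel_fun_real (u \o h)).
apply: borel_fun_comp => //; apply: continuous_borel_fun.
exact: lipschitz_continuous.
Qed.

Lemma measurable_sre (h : X -> F) : borel_fun h ->
  measurable_fun setT (fun x : borel X => sre (h x)).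
Proof.
by apply: borel_fun_lipschitz => a b; rewrite -sreB; exact: sabs_sre.
Qed.

Lemma measurable_sim (h : X -> F) : borel_fun h ->
  measurable_fun setT (fun x : borel X => sim (h x)).
Proof.
by apply: borel_fun_lipschitz => a b; rewrite -simB; exact: sabs_sim.
Qed.

Lemma measurable_sabs (h : X -> F) : borel_fun h ->
  measurable_fun setT (fun x : borel X => sabs (h x)).
Proof. by apply: borel_fun_lipschitz => a b; exact: sabs_dist. Qed.

Lemma measurable_sabs_sub (f h : X -> F) : borel_fun f -> borel_fun h ->
  measurable_fun setT (fun x : borel X => sabs (f x - h x)).
Proof.
move=> mf mh; under eq_fun do rewrite sabsE sreB simB.
apply: (measurableT_comp (f := @Num.sqrt R)).
  exact: continuous_measurable_fun (@sqrt_continuous R).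
by apply: measurable_funD; apply: measurable_funX; apply: measurable_funB;
  (exact: measurable_sre || exact: measurable_sim).
Qed.

End borel_functions.

(** * Inner product calculus with squared norms *)

Section inner_product_lemmas.
Variables (R : realType) (k : scalar_kind) (X : Type) (H : rkhs R k X).
Local Notation F := (scalar_field R k).
Local Notation ip := (rkhs_inner H).
Implicit Types (f g h : X -> F).

Lemma rkhsD f g : H f -> H g -> H (f + g).
Proof.
move=> Hf Hg; rewrite (_ : f + g = fun x => 1 * f x + g x).
  exact: rkhs_lin.
by apply/funext => x; rewrite mul1r.
Qed.

Lemma rkhsN f : H f -> H (- f).
Proof.
move=> Hf; rewrite (_ : - f = fun x => - 1 * f x + 0).
  by apply: rkhs_lin => //; exact: rkhs0.
by apply/funext => x; rewrite mulN1r addr0.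
Qed.

Lemma rkhsB f g : H f -> H g -> H (f - g).
Proof. by move=> Hf Hg; apply: rkhsD => //; exact: rkhsN. Qed.

Lemma rkhsMn f n : H f -> H (f *+ n).
Proof.
by move=> Hf; elim: n => [|n IH]; [exact: rkhs0|rewrite mulrS; exact: rkhsD].
Qed.

Lemma ipDl f g h : H f -> H g -> H h -> ip (f + g) h = ip f h + ip g h.
Proof.
move=> Hf Hg Hh; rewrite -[ip f h]mul1r -rkhs_inner_lin//.
by congr rkhs_inner; apply/funext => x; rewrite mul1r.
Qed.

Lemma ip0l h : H h -> ip 0 h = 0.
Proof.
move=> Hh; apply: (addrI (ip 0 h)).
by rewrite -ipDl ?addr0//; exact: rkhs0.
Qed.

Lemma ipNl f h : H f -> H h -> ip (- f) h = - ip f h.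
Proof.
move=> Hf Hh; apply: (addrI (ip f h)).
by rewrite -ipDl ?subrr ?ip0l//; exact: rkhsN.
Qed.

Lemma ipBl f g h : H f -> H g -> H h -> ip (f - g) h = ip f h - ip g h.
Proof. by move=> Hf Hg Hh; rewrite ipDl ?ipNl//; exact: rkhsN. Qed.

Lemma ipMnl f n h : H f -> H h -> ip (f *+ n) h = ip f h *+ n.
Proof.
move=> Hf Hh; elim: n => [|n IH]; first exact: ip0l.
by rewrite !mulrS ipDl ?IH//; exact: rkhsMn.
Qed.

Lemma ipC f g : H f -> H g -> ip f g = sconj (ip g f).
Proof. by move=> Hf Hg; rewrite rkhs_inner_conj. Qed.

Lemma ipDr f g h : H f -> H g -> H h -> ip h (f + g) = ip h f + ip h g.
Proof.
move=> Hf Hg Hh; rewrite ipC ?ipDl ?sconjD -?ipC//; exact: rkhsD.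
Qed.

Lemma ipNr f h : H f -> H h -> ip h (- f) = - ip h f.
Proof.
move=> Hf Hh; have HN := rkhsN Hf.
by rewrite ipC// ipNl// sconjN -ipC.
Qed.

Lemma ipMnr f n h : H f -> H h -> ip h (f *+ n) = ip h f *+ n.
Proof.
move=> Hf Hh; elim: n => [|n IH].
  by rewrite ipC ?ip0l ?sconj0//; exact: rkhs0.
by rewrite !mulrS ipDr ?IH//; exact: rkhsMn.
Qed.

Definition sqn f : R := sre (ip f f).

Lemma sqn_ge0 f : H f -> 0 <= sqn f.
Proof. by move=> Hf; exact/sre_ge0/rkhs_inner_ge0. Qed.

Lemma sqnD f g : H f -> H g -> sqn (f + g) = sqn f + sqn g + 2 * sre (ip f g).
Proof.
move=> Hf Hg; rewrite /sqn ipDl ?ipDr//; try exact: rkhsD.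
rewrite (ipC Hg Hf) !sreD sre_conj; ring.
Qed.

Lemma sqnN f : H f -> sqn (- f) = sqn f.
Proof.
move=> Hf; have HN := rkhsN Hf.
by rewrite /sqn ipNl// ipC// ipNl// sconjN opprK sre_conj.
Qed.

Lemma sqnB f g : H f -> H g -> sqn (f - g) = sqn f + sqn g - 2 * sre (ip f g).
Proof.
move=> Hf Hg; rewrite sqnD ?sqnN//; last exact: rkhsN.
rewrite (ipC Hf (rkhsN Hg)) sre_conj ipNl// sreN (ipC Hg Hf) sre_conj; ring.
Qed.

(** The parallelogram law with the nonnegative term [sqn H (f - g)] dropped; it serves as a triangle
    inequality for squared norms. *)
Lemma sqnD_le f g : H f -> H g -> sqn (f + g) <= 2 * sqn f + 2 * sqn g.
Proof.
move=> Hf Hg; have := sqn_ge0 (rkhsB Hf Hg); rewrite sqnB// sqnD//; lra.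
Qed.

Lemma sqnB_le f g h : H f -> H g -> H h ->
  sqn (f - h) <= 2 * sqn (f - g) + 2 * sqn (g - h).
Proof.
move=> Hf Hg Hh; rewrite -(subrKA g); apply: sqnD_le; exact: rkhsB.
Qed.

Lemma sqn_dC f g : H f -> H g -> sqn (f - g) = sqn (g - f).
Proof. by move=> Hf Hg; rewrite -sqnN ?opprB//; exact: rkhsB. Qed.

Lemma rkhs_norm_sqr f : H f -> rkhs_norm H f ^+ 2 = sqn f.
Proof. by move=> Hf; rewrite sqr_sqrtr//; exact: sqn_ge0. Qed.

Lemma rkhs_norm_ge0 f : 0 <= rkhs_norm H f.
Proof. exact: sqrtr_ge0. Qed.

Lemma rkhs_norm_lt f e : H f -> 0 < e -> sqn f < e ^+ 2 -> rkhs_norm H f < e.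
Proof.
move=> Hf e0; rewrite -rkhs_norm_sqr// ltr_pXn2r// nnegrE ?rkhs_norm_ge0//.
exact: ltW.
Qed.

Lemma rkhs_norm_le f g : H f -> H g -> sqn f <= sqn g ->
  rkhs_norm H f <= rkhs_norm H g.
Proof. by move=> Hf Hg fg; rewrite ler_sqrt//; exact: sqn_ge0. Qed.

Lemma sqnMn f n : H f -> sqn (f *+ n) = n%:R ^+ 2 * sqn f.
Proof.
move=> Hf; rewrite /sqn ipMnl ?ipMnr//; last exact: rkhsMn.
by rewrite !sreMn -mulrnA -[LHS]mulr_natl natrM expr2.
Qed.

(* Adding natural multiples of [b] to [a] keeps the squared norm
   nonnegative, so a negative [sre (ip a b)] would force [sqn b] to be
   bounded away from [0]. *)
Lemma sre_ip_ge0 f h (u : nat -> X -> F) : H f -> (forall n, H (u n)) ->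
  (forall n, ip f h = ip f (u n)) ->
  (forall e : R, 0 < e -> exists n, sqn (u n) < e) -> 0 <= sre (ip f h).
Proof.
move=> Hf Hu fu u0; rewrite leNgt; apply/negP => fh0.
(* With this [N], and [n] chosen so that [N%:R ^+ 2 * sqn (u n) < 1], the squared norm of
   [f + u n *+ N] would be negative. *)
have [N hN] : exists N : nat, sqn f + 1 < N%:R * - (2 * sre (ip f h)).
  exists (Num.truncn ((sqn f + 1) / - (2 * sre (ip f h)))).+1.
  by rewrite -ltr_pdivrMr ?truncnS_gt//; lra.
have N0 : 0 < N%:R :> R.
  rewrite ltr0n; case: N hN => //; rewrite mul0r => /lt_geF.
  by rewrite addr_ge0// sqn_ge0.
have [|n] := u0 (1 / N%:R ^+ 2); first by rewrite divr_gt0 ?exprn_gt0.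
rewrite ltr_pdivlMr ?exprn_gt0// mulrC => un.
have := sqn_ge0 (rkhsD Hf (rkhsMn N (Hu n))).
rewrite sqnD//; last exact: rkhsMn.
rewrite sqnMn// ipMnr// -fu sreMn -[sre _ *+ _]mulr_natl; lra.
Qed.

End inner_product_lemmas.

(** * Interpolation by finite combinations of kernel functions *)

Section interpolation.
Variables (R : realType) (k : scalar_kind) (X : eqType).
Local Notation F := (scalar_field R k).
Variables (H : rkhs R k X) (K : X -> X -> F) (hK : reproducing_kernel H K).
Local Notation ip := (rkhs_inner H).
Implicit Types (f g h : X -> F) (s t : seq X) (c : X -> F).

Definition kernel_sum s c : X -> F :=
  fun y => \sum_(x <- s) c x * feature K x y.

Lemma kernel_sum_nil c : kernel_sum [::] c = 0.
Proof. by apply/funext => y; rewrite /kernel_sum big_nil. Qed.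

Lemma kernel_sum_cons x s c :
  kernel_sum (x :: s) c = fun y => c x * feature K x y + kernel_sum s c y.
Proof. by apply/funext => y; rewrite /kernel_sum big_cons. Qed.

Lemma kernel_sum_rkhs s c : H (kernel_sum s c).
Proof.
elim: s => [|x s IH]; first by rewrite kernel_sum_nil; exact: rkhs0.
by rewrite kernel_sum_cons; apply: rkhs_lin => //; have [] := hK x.
Qed.

Lemma ip_kernel_suml s c h : H h ->
  ip (kernel_sum s c) h = \sum_(x <- s) c x * ip (feature K x) h.
Proof.
move=> Hh; elim: s => [|x s IH].
  by rewrite kernel_sum_nil big_nil; exact: ip0l.
have [Hx _] := hK x; rewrite kernel_sum_cons big_cons -IH.
by rewrite rkhs_inner_lin//; exact: kernel_sum_rkhs.
Qed.

(** By the reproducing property, [h] pairs with a combination of kernel functions only through its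
    values on [s]. All orthogonality relations below come from this. *)
Lemma ip_kernel_sum0 s c h : H h -> {in s, forall x, h x = 0} ->
  ip h (kernel_sum s c) = 0.
Proof.
move=> Hh h0; rewrite ipC//; last exact: kernel_sum_rkhs.
rewrite ip_kernel_suml// big_seq big1 ?sconj0// => x xs.
have [Hx ev] := hK x.
by rewrite ipC// -ev// h0// sconj0 mulr0.
Qed.

(* Gram-Schmidt: with [w] the part of the new kernel function [k_x] that
   vanishes on [s], one has [w x = ip w w]. If it is zero, [k_x] is already a
   combination of the others. *)
Lemma interpolation s f : uniq s -> H f ->
  exists c, {in s, kernel_sum s c =1 f}.
Proof.
elim: s f => [|x s IH] f /=; first by exists f.
move=> /andP[xs us] Hf; have [Hx ev] := hK x.
have [d hd] := IH _ us Hx; have [c hc] := IH _ us Hf.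
set u := kernel_sum s d in hd; set v := kernel_sum s c in hc.
have Hu : H u := kernel_sum_rkhs s d.
have Hv : H v := kernel_sum_rkhs s c.
pose w := feature K x - u; have Hw : H w by exact: rkhsB.
have w0 : {in s, forall y, w y = 0}.
  by move=> y /hd wy; rewrite /w !fctE wy subrr.
have wx : w x = ip w w.
  rewrite ev// -{1}(subrK u (feature K x)) ipDr//.
  by rewrite (ip_kernel_sum0 _ Hw w0) addr0.
(* The multiple of [w] that repairs the error of [v] at [x]; the values on [s] stay, since [w]
   vanishes there. The coefficients in the next line are those of [v + a (k_x - u)]. *)
pose a := (f x - v x) / w x.
exists (fun y => if y == x then a else c y - a * d y).
have E y : kernel_sum (x :: s) (fun y => if y == x then a else c y - a * d y) y
    = v y + a * w y.
  rewrite kernel_sum_cons eqxx /w !fctE /v /u /kernel_sum.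
  rewrite [in X in _ + X]big_seq.
  under eq_bigr => z zs.
    rewrite (_ : (z == x) = false); last by apply: contraNF xs => /eqP <-.
    rewrite mulrBl -mulrA; over.
  by rewrite -big_seq big_split/= sumrN -mulr_sumr; ring.
(* If [w] is zero then [k_x = u], and [f - v], which vanishes on [s], is orthogonal to [u]; its
   value at [x] is therefore zero. *)
have fvx : w x = 0 -> v x = f x.
  rewrite wx => /(rkhs_inner_eq0 Hw) ww.
  have ku : feature K x = u by apply/eqP; rewrite -subr_eq0 -/w ww.
  apply/esym/eqP; rewrite -subr_eq0 !ev// -ipBl// ku; apply/eqP.
  apply: ip_kernel_sum0; first exact: rkhsB.
  by move=> y /hc vy; rewrite !fctE vy subrr.
move=> y; rewrite inE E => /predU1P[->|ys]; last by rewrite w0// mulr0 addr0 hc.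
have [wx0|wn0] := eqVneq (w x) 0; first by rewrite wx0 mulr0 addr0 fvx.
by rewrite /a divfK// addrC subrK.
Qed.

End interpolation.

(** * Limits of interpolants of growing norm *)

Section approximation.
Variables (R : realType) (k : scalar_kind) (X : eqType).
Local Notation F := (scalar_field R k).
Variables (H : rkhs R k X) (K : X -> X -> F) (hK : reproducing_kernel H K).
Local Notation ip := (rkhs_inner H).
Local Notation q := (sqn H).
Local Notation ksum := (kernel_sum K).
Implicit Types (f g h : X -> F) (s t : seq X) (c : X -> F).

(** Pythagoras: [h - ksum s c] vanishes on [s] and so is orthogonal to [ksum s c]. *)
Lemma sqn_interpolant s c h : H h -> {in s, ksum s c =1 h} ->
  q h = q (ksum s c) + q (h - ksum s c).
Proof.
move=> Hh sch; have Hs := kernel_sum_rkhs hK s c.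
have := sqnD (rkhsB Hh Hs) Hs; rewrite subrK => ->.
rewrite ip_kernel_sum0//; last 2 first.
- exact: rkhsB.
- by move=> x /sch xh; rewrite !fctE xh subrr.
by rewrite sre0 mulr0 addr0 addrC.
Qed.

Lemma sqn_interpolant_le s c h : H h -> {in s, ksum s c =1 h} ->
  q (ksum s c) <= q h.
Proof.
move=> Hh sch; rewrite (sqn_interpolant Hh sch) lerDl sqn_ge0//.
exact/rkhsB/kernel_sum_rkhs.
Qed.

Lemma interpolant_limit (S : set X) f : H f ->
  exists (s : nat -> seq X) (c : nat -> X -> F) (l : X -> F),
    [/\ forall n, uniq (s n), forall n, {in s n, forall x, S x},
        rkhs_cvg H (fun n => ksum (s n) (c n)) l &
        [/\ H l, forall x, S x -> l x = f x & q l <= q f]].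
Proof.
move=> Hf; have Hs s c := kernel_sum_rkhs hK s c.
pose good (z : seq X * (X -> F)) := [/\ uniq z.1, {in z.1, forall x, S x} &
  {in z.1, ksum z.1 z.2 =1 f}].
pose A : set R := [set q (ksum z.1 z.2) | z in good].
have supA : has_sup A.
  split; first by exists (q (ksum [::] f)); exists ([::], f).
  by exists (q f) => _ [z [_ _ zf] <-]; exact: sqn_interpolant_le.
have [r r0 small] : exists2 r : nat -> R, forall n, 0 < r n &
    forall e, 0 < e -> exists N, forall n, (N <= n)%N -> r n < e.
  exists (fun n => n.+1%:R^-1) => [n|e e0]; first by rewrite invr_gt0.
  exists (Num.truncn e^-1) => n Nn.
  rewrite invf_plt ?posrE//; apply: (lt_le_trans (truncnS_gt _)).
  by rewrite ler_nat.
have /choice[z hz] : forall n : nat, exists z, good z /\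
    sup A - r n < q (ksum z.1 z.2).
  move=> n; have [_ [z gz <-] ?] := @sup_adherent _ A (r n) (r0 n) supA.
  by exists z.
pose v n := ksum (z n).1 (z n).2; have Hv n : H (v n) by exact: Hs.
(* An interpolant on a larger set [t] also interpolates along the points of [z n], so by Pythagoras
   its distance to [v n] is a gain in squared norm; that gain is below [r n] because [v n] is within
   [r n] of the supremum. *)
have refine n t c : uniq t -> {in t, forall x, S x} -> {subset (z n).1 <= t} ->
    {in t, ksum t c =1 f} -> q (ksum t c - v n) < r n.
  move=> ut tS zt tc; have [[_ _ zf] zn] := hz n.
  have zc : {in (z n).1, ksum (z n).1 (z n).2 =1 ksum t c}.
    by move=> x xz; rewrite zf// tc// zt.
  have := sqn_interpolant (Hs t c) zc; rewrite -/(v n) => E.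
  have : q (ksum t c) <= sup A.
    by apply: (sup_upper_bound supA); exists (t, c).
  by move=> tA; rewrite -(ltrD2l (q (v n))) -E (le_lt_trans tA)// -ltrBlDr.
(* Both [v m] and [v n] are compared with the interpolant on the union of their point sets. *)
have vv m n : q (v m - v n) < 2 * r m + 2 * r n.
  have [[_ mS _] _] := hz m; have [[_ nS _] _] := hz n.
  set t := undup ((z m).1 ++ (z n).1); have ut : uniq t by exact: undup_uniq.
  have tS : {in t, forall x, S x}.
    by move=> x; rewrite mem_undup mem_cat => /orP[/mS|/nS].
  have [c tc] := interpolation hK ut Hf.
  have /(_ ut tS) := @refine m t c; have /(_ ut tS) := @refine n t c.
  move=> /(_ _ tc) tn /(_ _ tc) tm.
  have {}tn : q (ksum t c - v n) < r n.
    by apply: tn => x; rewrite mem_undup mem_cat orbC => ->.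
  have {}tm : q (ksum t c - v m) < r m.
    by apply: tm => x; rewrite mem_undup mem_cat => ->.
  have := sqnB_le (Hv m) (Hs t c) (Hv n).
  rewrite (sqn_dC (Hv m) (Hs t c)); lra.
have [e e0|l Hl vl] := rkhs_complete Hv.
  have [|N hN] := small (e ^+ 2 / 4); first by rewrite divr_gt0 ?exprn_gt0.
  exists N => m n /hN Nm /hN Nn.
  apply: (@rkhs_norm_lt _ _ _ H (v m - v n)) => //; first exact: rkhsB.
  by have := vv m n; lra.
have lv e : 0 < e -> exists N, forall n, (N <= n)%N -> q (l - v n) < e.
  move=> e0; have se0 : 0 < Num.sqrt e by rewrite sqrtr_gt0.
  have /cvgrPdist_lt/(_ _ se0)[N _ hN] := vl.
  exists N => n /hN; rewrite sub0r normrN ger0_norm ?sqrtr_ge0//.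
  by rewrite /ip_norm ltr_sqrt// sqn_dC.
exists (fun n => (z n).1), (fun n => (z n).2), l.
(* Adding [x] to the points of [v n] gives an interpolant with the exact value [f x] at [x] that is
   still close to [v n], hence to [l]; boundedness of evaluation at [x] concludes. *)
have lS x : S x -> l x = f x.
  move=> Sx; apply/eqP; rewrite -subr_eq0; apply/eqP/sabs_eq0/eqP.
  rewrite eq_le sabs_ge0 andbT leNgt; apply/negP => a0.
  set a := sabs _ in a0; have [C hC] := rkhs_eval_bounded H x.
  have C0 : 0 < C ^+ 2 + 1 by rewrite ltr_wpDl ?sqr_ge0.
  (* The distance estimate yields [4 * e] for the squared norm of [l - ksum t c], and
     [C ^+ 2 * (4 * e) < a ^+ 2]. The summand 1 keeps the denominator positive when [C] is zero. *)
  pose e := a ^+ 2 / (C ^+ 2 + 1) / 4.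
  have e0 : 0 < e by rewrite !divr_gt0 ?exprn_gt0.
  have [N1 /(_ (maxn N1 _) (leq_maxl _ _)) h1] := lv _ e0.
  have [N2 /(_ (maxn N1 N2) (leq_maxr _ _)) h2] := small _ e0.
  move: {h1}(h1 N2) h2; set n := maxn _ _ => h1 h2.
  have [[_ nS _] _] := hz n.
  set t := undup (x :: (z n).1); have ut : uniq t by exact: undup_uniq.
  have tS : {in t, forall x, S x}.
    by move=> y; rewrite mem_undup inE => /predU1P[->|/nS].
  have [c tc] := interpolation hK ut Hf.
  have tn : q (ksum t c - v n) < r n.
    by apply: refine => // y yz; rewrite mem_undup inE yz orbT.
  have xt : x \in t by rewrite mem_undup mem_head.
  have := sqnB_le Hl (Hv n) (Hs t c); rewrite (sqn_dC (Hv n) (Hs t c)) => le4.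
  have {}le4 : q (l - ksum t c) < 4 * e by lra.
  have aC : a <= C * rkhs_norm H (l - ksum t c).
    by have := hC _ (rkhsB Hl (Hs t c)); rewrite !fctE tc.
  have : a ^+ 2 <= C ^+ 2 * q (l - ksum t c).
    rewrite -rkhs_norm_sqr; last exact: rkhsB.
    by rewrite -exprMn lerXn2r// nnegrE ltW// (lt_le_trans a0).
  have C2 : C ^+ 2 * q (l - ksum t c) <= C ^+ 2 * (4 * e).
    by rewrite ler_wpM2l ?sqr_ge0// ltW.
  have : (C ^+ 2 + 1) * (4 * e) = a ^+ 2.
    by rewrite /e; field; rewrite gt_eqF.
  lra.
split => //.
- by move=> n; have [[]] := hz n.
- by move=> n; have [[]] := hz n.
split => //.
have Hfl := rkhsB Hf Hl.
have fl0 n : rkhs_inner H (f - l) (v n) = 0.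
  apply: ip_kernel_sum0 => // x xn; have [[_ /(_ x xn) Sx _] _] := hz n.
  by rewrite !fctE lS// subrr.
have := sqnD Hfl Hl; rewrite subrK => ->.
(* As [f - l] is orthogonal to every [v n], its product with [l] equals that with [l - v n], which
   is arbitrarily short. *)
have : 0 <= sre (rkhs_inner H (f - l) l).
  apply: (@sre_ip_ge0 _ _ _ H _ _ (fun n => l - v n)) => //.
  - by move=> n; exact: rkhsB.
  - move=> n; have HN := rkhsN (Hv n).
    by rewrite ipDr// ipNr// fl0 oppr0 addr0.
  - by move=> e /lv[N hN]; exists N; exact: hN.
by have := sqn_ge0 Hfl; lra.
Qed.

End approximation.

(** Each [h] acts as a linear functional on the vectors [B x] of values of the spanning family. If
    the [B x] with [x] in [s] span a space of maximal dimension among finite parts of [S], that span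
    contains [B x] for every [x] in [S], and a functional vanishing on it vanishes on all of
    them. *)
Lemma finite_dimensional_determined (R : realType) (k : scalar_kind)
    (X : eqType) (H : rkhs R k X) (S : set X) : finite_dimensional H ->
  exists s : seq X, [/\ uniq s, {in s, forall x, S x} &
    forall h, H h -> {in s, forall x, h x = 0} -> forall x, S x -> h x = 0].
Proof.
move=> [n [b [_ bH]]]; pose B x : 'rV_n := \row_i b i x.
pose P m := `[< exists s, {in s, forall x, S x} /\
  m = \dim <<[seq B x | x <- s]>>%VS >].
have exP : exists m, P m.
  exists (\dim <<[seq B x | x <- [::]]>>%VS); apply/asboolP.
  by exists [::].
have leP m : P m -> (m <= n)%N.
  move=> /asboolP[s [_ ->]]; apply: leq_trans (dimvS (subvf _)) _.
  by rewrite dimvf /dim /= mul1n.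
have [m /asboolP[s [sS ms]] mmax] := ex_maxnP exP leP.
exists (undup s); split; first exact: undup_uniq.
  by move=> x; rewrite mem_undup => /sS.
move=> h Hh h0 x Sx; have [c hc] := bH h Hh.
pose phi := linfun (mulmxr (\col_i c i) : 'rV_n -> 'rV_1).
have phiB y : phi (B y) = 0 <-> h y = 0.
  have E : phi (B y) 0 0 = h y.
    rewrite lfunE /= mxE hc; apply: eq_bigr => i _; rewrite !mxE mulrC//.
  split=> [|hy]; first by rewrite -E => ->; rewrite mxE.
  by apply/matrixP => i j; rewrite !ord1 E hy mxE.
have sker : (<<[seq B x | x <- s]>> <= lker phi)%VS.
  apply/span_subvP => _ /mapP[y ys ->]; rewrite memv_ker; apply/eqP/phiB/h0.
  by rewrite mem_undup.
apply/phiB/eqP; rewrite -memv_ker; apply: (subvP sker).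
have sub : (<<[seq B x | x <- s]>> <= <<[seq B x | x <- x :: s]>>)%VS.
  by rewrite /= span_cons addvSr.
have /eqP -> : (<<[seq B x | x <- s]>> == <<[seq B x | x <- x :: s]>>)%VS.
  rewrite eqEdim sub -ms; apply: mmax; apply/asboolP; exists (x :: s).
  by split => // y; rewrite inE => /predU1P[->|/sS].
by apply: memv_span; rewrite /= mem_head.
Qed.


(** * Support and Borel sets of a Polish space *)

Section polish_borel.
Variables (R : realType) (X : ptopologicalType) (hX : polish R X).

Lemma polish_open_ball (d : X -> X -> R) (x : X) (e : R) :
  (forall x y z, d x z <= d x y + d y z) ->
  (forall (x : X) (A : set X),
    nbhs x A <-> exists2 e : R, 0 < e & [set y | d x y < e] `<=` A) ->
  open [set y | d x y < e].
Proof.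
move=> dD dnbhs; rewrite openE => y /= yx.
apply/dnbhs; exists (e - d x y); first by rewrite subr_gt0.
by move=> z /= yz; apply: le_lt_trans (dD x y z) _; rewrite -ltrBrDl.
Qed.

Lemma polish_measurable1 (x : X) : measurable ([set x] : set (borel X)).
Proof.
have [_ [d [d0 dC dD dnbhs _]]] := hX.
rewrite -[X in measurable X]setCK; apply: measurableC.
apply: open_measurable_borel; rewrite openE => y /= yx.
(* Nonnegativity of [d] follows from the triangle inequality along [u], [v], [u]. *)
have dge0 u v : 0 <= d u v.
  have := dD u v u; rewrite (dC v u) (proj2 (d0 u u) erefl); lra.
apply/dnbhs; exists (d y x).
  by rewrite lt_neqAle dge0 andbT eq_sym; apply/eqP => /d0.
by move=> z /= + zx; rewrite zx ltxx.
Qed.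

(** A point outside the support has a null neighbourhood and so lies in a null ball with centre in a
    countable dense set and radius [r n]; there are countably many such balls. *)
Lemma msupport_negligible (mu : {measure set (borel X) -> \bar R}) :
  mu.-negligible (~` msupport mu).
Proof.
have [[D cD dD] [d [d0 dC dtri dnbhs _]]] := hX.
have /countable_injP[f finj] := cD.
have oB q e : open [set y | d q y < e] by exact: polish_open_ball.
pose r n : R := n.+1%:R^-1.
(* [E j n] is the ball of radius [r n] around the point of [D] numbered [j] by [f] if such a point
   exists and its ball is null; otherwise it is empty. *)
pose E j n : set (borel X) := [set y | exists q,
  [/\ D q, f q = j, mu [set y | d q y < r n] = 0%E & d q y < r n]].
have E0 j n : mu.-negligible (E j n).
  have [[q [Dq fq mq]]|nq] := pselect (exists q, [/\ D q, f q = j &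
      mu [set y | d q y < r n] = 0%E]).
    exists [set y | d q y < r n]; split => //.
      exact: open_measurable_borel (oB _ _).
    move=> y [q' [Dq' fq' _ +]]; suff -> : q' = q by [].
    by apply: finj; rewrite ?inE ?fq ?fq'.
  rewrite (_ : E j n = set0); first exact: negligible_set0.
  by rewrite -subset0 => y [q [Dq fq mq _]]; apply: nq; exists q.
apply: (@negligibleS _ _ _ _ (\bigcup_j \bigcup_n E j n)); last first.
  by apply: negligible_bigcup => j; exact: negligible_bigcup.
move=> x /=; rewrite /msupport /= => nx.
have [U [oU Ux mU]] : exists U, [/\ open U, U x & mu (U : set (borel X)) = 0%E].
  apply: contrapT => nU; apply: nx => U oU Ux.
  rewrite lt_neqAle measure_ge0 andbT; apply/eqP => mU0.
  by apply: nU; exists U.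
have /dnbhs[e e0 eU] : nbhs x U by exact: open_nbhs_nbhs.
(* A ball of radius below [e / 2] that contains [x] lies in the ball of radius [e] around [x], hence
   in [U]. *)
pose n := Num.truncn (e / 2)^-1.
have rn : r n < e / 2.
  by rewrite invf_plt ?posrE ?divr_gt0// truncnS_gt.
have [q [/= xq Dq]] : [set y | d x y < r n] `&` D !=set0.
  apply: dD; last exact: oB.
  by exists x; rewrite /= (proj2 (d0 x x) erefl) invr_gt0.
exists (f q) => //; exists n => //; exists q; split => //; last by rewrite dC.
apply/eqP; rewrite eq_le measure_ge0 andbT -mU; apply: le_measure.
- by rewrite inE; exact: open_measurable_borel (oB _ _).
- by rewrite inE; exact: open_measurable_borel.
- move=> y /= qy; apply: eU => /=; have := dtri x q y; lra.
Qed.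

Lemma objective_support (k : scalar_kind)
    (mu : {measure set (borel X) -> \bar R}) (p : R)
    (g f1 f2 : X -> scalar_field R k) :
  borel_fun g -> borel_fun f1 -> borel_fun f2 ->
  (forall x, msupport mu x -> f1 x = f2 x) ->
  objective mu p g f1 = objective mu p g f2.
Proof.
move=> mg m1 m2 f12.
have mI f : borel_fun f ->
    measurable_fun setT (fun x : borel X => (sabs (f x - g x) `^ p)%:E).
  move=> mf; apply/measurable_EFinP.
  apply: (measurableT_comp (f := fun a : R => a `^ p)).
    exact: measurable_powR.
  exact: measurable_sabs_sub.
apply: ge0_ae_eq_integral => //; [exact: mI|exact: mI|..].
- by move=> x _; rewrite lee_fin powR_ge0.
- by move=> x _; rewrite lee_fin powR_ge0.
apply: negligibleS (msupport_negligible mu) => x /= nE Sx; apply: nE => _.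
by rewrite f12.
Qed.

End polish_borel.

(** * Finite sums of weighted Dirac masses and their signed integrals *)

Section discrete_measures.
Variables (R : realType) (X : ptopologicalType).
Implicit Types (s : seq X) (w : X -> {nonneg R}) (A : set (borel X)).

(** Repeated points count with multiplicity. The default [point] is never reached, as the indices
    stay below [size s]. *)
Definition discrete_measure s w : {measure set (borel X) -> \bar R} :=
  msum (fun n => mscale (w (nth point s n)) (\d_(nth point s n : borel X)))
    (size s).

Lemma discrete_measureE s w A :
  discrete_measure s w A = (\sum_(x <- s) (w x)%:num * \1_A x)%:E.
Proof.
rewrite /discrete_measure /= /msum /mscale /= /dirac.
rewrite (big_nth point) big_mkord -sumEFin; apply: eq_bigr => i _.
by rewrite EFinM.
Qed.

Lemma ge0_integral_discrete s w (h : borel X -> R) :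
  measurable_fun setT h -> (forall x, 0 <= h x) ->
  (\int[discrete_measure s w]_(x in setT) (h x)%:E =
   (\sum_(x <- s) (w x)%:num * h x)%:E)%E.
Proof.
move=> mh h0; have mh' : measurable_fun setT (EFin \o h).
  exact/measurable_EFinP.
rewrite ge0_integral_measure_sum//; last by move=> x _; rewrite lee_fin.
rewrite (big_nth point) big_mkord -sumEFin; apply: eq_bigr => i _.
rewrite ge0_integral_mscale//; last by move=> x _; rewrite lee_fin.
by rewrite integral_dirac// diracT mul1e.
Qed.

Lemma integral_discrete s w (h : borel X -> R) : measurable_fun setT h ->
  (\int[discrete_measure s w]_(x in setT) (h x)%:E =
   (\sum_(x <- s) (w x)%:num * h x)%:E)%E.
Proof.
move=> mh; rewrite integralE -[fun x => (h x)%:E]/(EFin \o h).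
rewrite funerpos funerneg !ge0_integral_discrete//.
- rewrite -EFinB -sumrB; congr EFin; apply: eq_bigr => x _.
  by rewrite -mulrBr -[in RHS](funrposBneg h).
- exact: measurable_funrneg.
- exact: measurable_funrpos.
Qed.

Lemma measurable_set_seq s (hX : polish R X) :
  measurable ([set x | x \in s] : set (borel X)).
Proof.
elim: s => [|y s IH].
  by rewrite [X in measurable X](_ : _ = set0)// -subset0.
rewrite [X in measurable X](_ : _ = [set y] `|` [set x | x \in s]).
  by apply: measurableU => //; exact: polish_measurable1 hX y.
by apply/seteqP; split => x /=; rewrite inE => /predU1P.

Qed.

Fact pos_part_ge0 (r : R) : 0 <= Num.max r 0.
Proof. by rewrite le_max lexx orbT. Qed.

Definition pos_weight (r : X -> R) (x : X) : {nonneg R} :=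
  NngNum (pos_part_ge0 (r x)).

Definition discrete_sum s (r : X -> R) A : R := \sum_(x <- s) r x * \1_A x.

(** The supremum is attained at the finite set of those points of [s] in [A] whose weight is
    positive. Weights depend on the point alone, so repeated entries cannot cancel. *)
Lemma upper_variation_discrete s (r : X -> R) : polish R X ->
  upper_variation (discrete_sum s r) = discrete_measure s (pos_weight r).
Proof.
move=> hX; apply/funext => A; rewrite discrete_measureE.
apply/eqP; rewrite eq_le; apply/andP; split.
  apply: ge_ereal_sup => _ [B [_ BA] <-]; rewrite lee_fin.
  apply: ler_sum => x _; rewrite !indicE /=.
  have [xB|xB] := boolP (x \in B).
    by rewrite (mem_set (BA _ (set_mem xB))) !mulr1 le_max lexx.
  by rewrite mulr0 mulr_ge0// pos_part_ge0.
pose B : set X := [set x | x \in [seq x <- s | (0 < r x) && (x \in A)]].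
apply: ereal_sup_ubound; exists B.
  split; first exact: measurable_set_seq.
  by move=> x; rewrite /B /= mem_filter => /andP[/andP[_ /set_mem]].
congr EFin; rewrite /discrete_sum !big_seq; apply: eq_bigr => x xs.
rewrite !indicE /= [x \in B]asboolb mem_filter xs andbT.
by case: (ltP 0 (r x)) => [r0|r0]; rewrite ?andbT//= mulr0 mul0r.
Qed.

Lemma signed_integral_discrete s (r h : X -> R) : polish R X ->
  measurable_fun setT (h : borel X -> R) ->
  signed_integral (discrete_sum s r) h = \sum_(x <- s) r x * h x.
Proof.
move=> hX mh; rewrite /signed_integral.
have -> : (fun A => - discrete_sum s r A) = discrete_sum s (fun x => - r x).
  apply/funext => A; rewrite /discrete_sum -sumrN.
  by apply: eq_bigr => x _; rewrite mulNr.
rewrite !upper_variation_discrete// !integral_discrete//= -sumrB.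
apply: eq_bigr => x _; rewrite -mulrBl; congr (_ * _).
by case: (ltP 0 (r x)) => r0; case: (ltP 0 (- r x)) => ?; lra.
Qed.

End discrete_measures.

(** * Scalar-valued discrete measures, their variation and support *)

Section discrete_charges.
Variables (R : realType) (k : scalar_kind) (X : ptopologicalType).
Local Notation F := (scalar_field R k).
Implicit Types (s : seq X) (c : X -> F) (A : set (borel X)).

Definition discrete_charge s c A : \bar F :=
  (\sum_(x <- s) c x * \1_A x)%:E.

Lemma indic_bigsetU (E : nat -> set (borel X)) n (x : borel X) :
  trivIset setT E ->
  \1_(\big[setU/set0]_(i < n) E i) x = \sum_(i < n) \1_(E i) x :> F.
Proof.
move=> tE; elim: n => [|n IH]; first by rewrite !big_ord0 indic0.
rewrite !big_ord_recr /= -IH !indicE.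
have E0 : \big[setU/set0]_(i < n) E i `&` E n = set0.
  apply: (@trivIset_bigsetUI _ xpredT E) => //.
  by apply: sub_trivIset tE.
rewrite in_setU; have [xn|xn] := boolP (x \in E n); last first.
  by rewrite orbF addr0.
rewrite orbT (_ : (x \in _) = false) ?add0r//; apply/negbTE/negP => xU.
suff : set0 x by []; rewrite -E0; split; exact: set_mem.
Qed.

Let discrete_charge_finite s c : fin_num_fun (discrete_charge s c).
Proof. by []. Qed.

Let discrete_charge_additive s c :
  measure_function.semi_additive (discrete_charge s c).
Proof.
move=> E n _ tE _; rewrite /discrete_charge sumEFin; congr EFin.
under eq_bigr do rewrite indic_bigsetU// mulr_sumr.
by rewrite exchange_big.
Qed.

(** The partial sums are eventually constant: finitely many sets [E i] capture every point of [s]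
    that lies in the union. *)
Let discrete_charge_sigma_additive s c :
  semi_sigma_additive (discrete_charge s c).
Proof.
move=> E mE tE mUE.
have [N hN] : exists N, forall n, (N <= n)%N -> {in s, forall x,
    \1_(\big[setU/set0]_(i < n) E i) x = \1_(\bigcup_i E i) x :> F}.
  elim: s => [|y s [N IH]]; first by exists 0%N.
  have [[j _ yj]|yE] := pselect ((\bigcup_i E i) y); last first.
    exists N => n Nn x; rewrite inE => /predU1P[->|]; last exact: IH.
    rewrite !indicE !memNset// -bigcup_mkord => -[i _ yi].
    by apply: yE; exists i.
  exists (maxn N j.+1) => n; rewrite geq_max => /andP[Nn jn] x.
  rewrite inE => /predU1P[->|]; last exact: IH.
  have yU : (\bigcup_i E i) y by exists j.
  have yn : (\big[setU/set0]_(i < n) E i) y by rewrite -bigcup_mkord; exists j.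
  by rewrite !indicE (mem_set yU) (mem_set yn).
move=> P /= Pl.
have {}Pl : P (discrete_charge s c (\bigcup_i E i)).
  exact: (@nbhs_singleton F _ (fun z => P z%:E)).
exists N => // n /= Nn.
rewrite big_mkord -discrete_charge_additive//; last exact: bigsetU_measurable.
rewrite (_ : discrete_charge s c _ = discrete_charge s c (\bigcup_i E i))//.
congr EFin; apply: eq_big_seq => x xs.
by congr (_ * _); exact: hN.
Qed.

HB.instance Definition _ s c := isFinite.Build _ _ _ (discrete_charge s c)
  (@discrete_charge_finite s c).
HB.instance Definition _ s c := isAdditiveCharge.Build _ _ _
  (discrete_charge s c) (@discrete_charge_additive s c).
HB.instance Definition _ s c := isSemiSigmaAdditive.Build _ _ _
  (discrete_charge s c) (@discrete_charge_sigma_additive s c).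

Definition discrete_Fmeasure s c : Fmeasure R k X := discrete_charge s c.

Definition abs_weight c (x : X) : {nonneg R} := NngNum (sabs_ge0 (c x)).

(** The triangle inequality on each piece of a partition, summed by countable additivity of the
    discrete measure. *)
Lemma Fvariation_discrete_le s c A :
  (Fvariation (discrete_charge s c) A <=
   discrete_measure s (abs_weight c) A)%E.
Proof.
apply: ge_ereal_sup => _ [E [mE tE <- ->]].
rewrite measure_semi_bigcup//; last exact: bigcupT_measurable.
apply: lee_nneseries => [i _ _|i _]; first by rewrite lee_fin sabs_ge0.
rewrite discrete_measureE lee_fin /=; apply: le_trans (sabs_sum _ _ _) _.
apply: ler_sum => x _; rewrite sabsM /= !indicE.
by case: (x \in E i); rewrite ?mulr1n ?mulr0n ?sabs0// sabs1.
Qed.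

Lemma Fvariation_ge0 (xi : set (borel X) -> \bar F) A : measurable A ->
  (0 <= Fvariation xi A)%E.
Proof.
move=> mA; pose E i := if i is 0%N then A else set0.
apply: le_trans (ereal_sup_ubound _); last first.
  exists E; split; last reflexivity.
  - by case=> [|i]; [exact: mA|exact: measurable0].
  - by move=> [|i] [|j] _ _ [x []].
  - apply/seteqP; split => [x [[|i] _]//|x Ax]; by exists 0%N.
by apply: nneseries_ge0 => i _ _; rewrite lee_fin sabs_ge0.
Qed.

(** An open set that is null for [mu] contains no point of [s], so the variation vanishes on it. *)
Lemma Fsupport_discrete s c (mu : set (borel X) -> \bar R) :
  {in s, forall x, msupport mu x} ->
  Fsupport (discrete_Fmeasure s c) `<=` msupport mu.
Proof.
move=> sS x xnu U oU Ux; rewrite ltNge; apply/negP => mU.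
have := xnu U oU Ux; apply/negP; rewrite -leNgt.
apply: le_trans (Fvariation_discrete_le s c U) _.
rewrite discrete_measureE lee_fin big_seq big1// => y ys.
rewrite indicE memNset ?mulr0// => Uy.
by have := sS _ ys U oU Uy; rewrite ltNge mU.
Qed.

End discrete_charges.

Import HBNNSimple.

(** Meant for [n] a variation, taken here as a bare set function. The comparison is made on simple
    functions, whose integrals are sums with nonnegative coefficients, and passes to suprema. *)
Lemma le_measure_integral (d : measure_display) (T : measurableType d)
    (R : realType) (n : set T -> \bar R) (m : {measure set T -> \bar R})
    (f : T -> \bar R) :
  (forall A, measurable A -> (0 <= n A <= m A)%E) -> (forall x, 0 <= f x)%E ->
  (\int[n]_(x in setT) f x <= \int[m]_(x in setT) f x)%E.
Proof.
move=> nm f0.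
have n0 : n set0 = 0%E.
  apply/eqP; rewrite eq_le; have /andP[-> +] := nm set0 measurable0.
  by rewrite measure0 andbT.
have sE (h : {nnsfun T >-> R}) (mu : set T -> \bar R) : mu set0 = 0%E ->
    sintegral mu h = (\sum_(x \in range h) x%:E * mu (h @^-1` [set x]))%E.
  move=> mu0; rewrite /sintegral (fsbig_widen (range h) setT)//= => x [_ Nx] /=.
  by rewrite preimage10// mu0 mule0.
have snm (h : {nnsfun T >-> R}) : (0 <= sintegral n h <= sintegral m h)%E.
  have hge0 x : range h x -> 0 <= x by move=> [t _ <-].
  have mh x : measurable (h @^-1` [set x]) by exact: measurable_sfunP.
  rewrite !sE ?measure0//; apply/andP; split.
    apply: fsume_ge0 => x /hge0 x0; apply: mule_ge0; rewrite ?lee_fin//.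
    by have /andP[] := nm _ (mh x).
  apply: lee_fsum => [|x /hge0 x0]; first exact: fimfunP.
  by apply: lee_wpmul2l; [rewrite lee_fin|have /andP[] := nm _ (mh x)].
rewrite [leRHS]ge0_integralTE// /integral patch_setT.
rewrite (_ : f^\+ = f)%E; last first.
  by apply/funext => x; rewrite (@ge0_funeposE _ _ setT) ?inE.
apply: (@le_trans _ _ (ereal_sup [set sintegral n h |
    h in [set h : {nnsfun T >-> R} | forall x, ((h x)%:E <= f x)%E]])).
  (* The integral subtracts a supremum for the negative part, which is at least the value at the
     zero simple function and hence nonnegative. *)
  apply: geeDl; rewrite leeNl oppe0.
  have /andP[s0 _] := snm nnsfun0; apply: le_trans s0 _.
  by apply: ereal_sup_ubound; exists nnsfun0 => // x; exact: funeneg_ge0.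
apply: ge_ereal_sup => _ [h hf <-]; have /andP[_ hm] := snm h.
by apply: le_trans hm _; apply: ereal_sup_ubound; exists h.
Qed.

(** * Pettis integrals of the feature map against discrete measures *)

Section discrete_pettis.
Variables (R : realType) (k : scalar_kind) (X : ptopologicalType).
Local Notation F := (scalar_field R k).
Variables (hX : polish R X).

Lemma Fintegral_discrete (s : seq X) (c h : X -> F) : borel_fun h ->
  Fintegral (discrete_Fmeasure s c) h = \sum_(x <- s) c x * h x.
Proof.
move=> mh; rewrite /Fintegral.
have cE z (A : set (borel X)) x :
    sre (z * \1_A x : F) = sre z * \1_A x /\
    sim (z * \1_A x : F) = sim z * \1_A x.
  by rewrite !indicE; case: (x \in A); rewrite ?mulr1 ?mulr0 ?sre0 ?sim0.
have -> : (fun A => sre (fine (discrete_Fmeasure s c A))) =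
    discrete_sum s (fun x => sre (c x)).
  apply/funext => A; rewrite sre_sum; apply: eq_bigr => x _.
  by case: (cE (c x) A x).
have -> : (fun A => sim (fine (discrete_Fmeasure s c A))) =
    discrete_sum s (fun x => sim (c x)).
  apply/funext => A; rewrite sim_sum; apply: eq_bigr => x _.
  by case: (cE (c x) A x).
have mr := measurable_sre mh; have mi := measurable_sim mh.
rewrite !signed_integral_discrete// -sumrB -big_split/=.
rewrite -[RHS]smakeK sre_sum sim_sum; congr smake; apply: eq_bigr => x _.
  by rewrite sreM.
by rewrite simM.
Qed.

Lemma Fintegrable_discrete (s : seq X) (c h : X -> F) : borel_fun h ->
  Fintegrable (discrete_Fmeasure s c) h.
Proof.
move=> mh; split => //.
apply: (@le_lt_trans _ _ (\int[discrete_measure s (abs_weight c)]_(x in setT)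
    (sabs (h x))%:E)%E).
  apply: le_measure_integral => [A mA|x]; last by rewrite lee_fin sabs_ge0.
  by rewrite Fvariation_ge0// Fvariation_discrete_le.
rewrite ge0_integral_discrete ?ltry//; first exact: measurable_sabs.
by move=> x; exact: sabs_ge0.
Qed.

Variables (H : rkhs R k X) (K : X -> X -> F) (hK : reproducing_kernel H K).
Hypothesis hHmeas : forall f : X -> F, H f -> borel_fun f.

Lemma pettis_discrete (s : seq X) (c : X -> F) :
  is_pettis_integral H (feature K) (discrete_Fmeasure s c) (kernel_sum K s c).
Proof.
split=> [|f Hf]; first exact: kernel_sum_rkhs.
(* By the reproducing property and conjugate symmetry the integrand is the conjugate of [f]. *)
have mf : borel_fun (fun x => rkhs_inner H (feature K x) f).
  rewrite (_ : (fun _ => _) = @sconj R k \o f).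
    apply: borel_fun_comp; last exact: hHmeas.
    by apply: continuous_borel_fun; exact: sconj_continuous.
  by apply/funext => x; have [Hx ev] := hK x; rewrite ipC// -ev.
split; first exact: Fintegrable_discrete.
by rewrite Fintegral_discrete// ip_kernel_suml.
Qed.

End discrete_pettis.

Theorem corollary3p5 (R : realType) (k : scalar_kind) (X : ptopologicalType)
  (hX : polish R X)
  (H : rkhs R k X) (K : X -> X -> scalar_field R k)
  (hK : reproducing_kernel H K)
  (hHmeas : forall f : X -> scalar_field R k, H f -> borel_fun f)
  (hphimeas : borel_fun (fun x => rkhs_norm H (feature K x)))
  (mu : probability (borel X) R)
  (M p : R) (hM : 0 < M) (hp : 1 < p)
  (g : X -> scalar_field R k) (hgmeas : borel_fun g)
  (hg : mu.-integrable setT (fun x => (sabs (g x) `^ p)%:E))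
  (fhat : X -> scalar_field R k)
  (hfhat : optimizer H mu p M g fhat)
  (hfhat_unique : forall f, optimizer H mu p M g f -> f = fhat)
  (hmu : forall xi : Fmeasure R k X, Fsupport xi `<=` msupport mu ->
    (\int[Fvariation xi]_(x in setT) (rkhs_norm H (feature K x))%:E < +oo)%E) :
  (exists (nu : nat -> Fmeasure R k X) (v : nat -> X -> scalar_field R k),
    [/\ forall n, Fsupport (nu n) `<=` msupport mu,
        forall n, is_pettis_integral H (feature K) (nu n) (v n) &
        rkhs_cvg H v fhat]) /\
  (finite_set (msupport mu) \/ finite_dimensional H ->
    exists nu : Fmeasure R k X,
      Fsupport nu `<=` msupport mu /\
      is_pettis_integral H (feature K) nu fhat).
Proof.
have [[Hf fM] fopt] := hfhat.
have opt l : H l -> (forall x, msupport mu x -> l x = fhat x) ->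
    sqn H l <= sqn H fhat -> l = fhat.
  move=> Hl lf lle; apply: hfhat_unique; split.
    by split => //; apply: le_trans fM; exact: rkhs_norm_le.
  by rewrite -fopt; apply: objective_support => //; exact: hHmeas.
split.
  have [s [c [l [us sS vl [Hl lf lle]]]]] :=
    interpolant_limit hK (msupport mu) Hf.
  exists (fun n => discrete_Fmeasure (s n) (c n)).
  exists (fun n => kernel_sum K (s n) (c n)); split.
  - by move=> n; apply: Fsupport_discrete (sS n).
  - by move=> n; exact: pettis_discrete.
  - by rewrite -(opt l).
move=> fin.
(* It is enough to find finitely many points of the support whose values determine those on the
   whole support: the interpolant of [fhat] there agrees with [fhat] on the support and is not
   longer. *)
suff [s [us sS sd]] : exists s : seq X, [/\ uniq s,
    {in s, forall x, msupport mu x} &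
    forall h, H h -> {in s, forall x, h x = 0} ->
      forall x, msupport mu x -> h x = 0].
  have [c sc] := interpolation hK us Hf.
  exists (discrete_Fmeasure s c); split; first exact: Fsupport_discrete sS.
  rewrite -(opt (kernel_sum K s c)); first exact: pettis_discrete.
  - exact: kernel_sum_rkhs.
  - move=> x Sx; apply/eqP; rewrite -subr_eq0; apply/eqP.
    apply: (sd (kernel_sum K s c - fhat)) => //.
      by apply: rkhsB => //; exact: kernel_sum_rkhs.
    by move=> y /sc yf; rewrite !fctE yf subrr.
  - exact: sqn_interpolant_le.
case: fin => [|]; last exact: finite_dimensional_determined.
move=> /finite_seqP[s sE]; exists (undup s); split; first exact: undup_uniq.
  by move=> x; rewrite mem_undup sE.
by move=> h _ h0 x; rewrite sE /= -mem_undup => /h0.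
Qed.
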